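(* Let $t \ge 4$ be a rational number and let $G$ be a $t$-tough graph on $n \ge 3$ vertices. Suppose that $G$ is not Hamiltonian, but there exists $z \in V(G)$ such that $G - z$ has a Hamilton cycle $C$, and fix an orientation of $C$. Then for any distinct $x, y \in (N(z))^+$, we have $\deg(x) + \deg(y) < n - t$.
   Context: Graphs are simple, undirected and finite. Let $c(H)$ denote the number of components of a graph $H$. For a real number $t \ge 0$, $G$ is $t$-tough if $|S| \ge t \cdot c(G-S)$ for all $S \subseteq V(G)$ with $c(G-S) \ge 2$ (so complete graphs are $t$-tough for every $t$). A graph is Hamiltonian if it has a cycle containing all its vertices (a Hamilton cycle). $N(z)$ is the set of neighbors of $z$ in $G$, and $\deg$ denotes degree in $G$. For a cycle $C$ with a fixed orientation and $u \in V(C)$, $u^+$ is the immediate successor of $u$ on $C$ along the orientation; for $S \subseteq V(C)$, $S^+ = \{u^+ : u \in S\}$. Here $N(z) \subseteq V(G)\setminus\{z\} = V(C)$, so $(N(z))^+$ is well defined. *)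

(* Defs.v *)
From mathcomp Require Import all_boot all_order all_algebra.

Set Implicit Arguments.
Unset Strict Implicit.
Unset Printing Implicit Defensive.

Import Order.TTheory GRing.Theory Num.Theory.

(* A simple graph is a symmetric irreflexive [e : rel T] on [T : finType].     *)
(* Subgraphs keep the vertex type [T]: [induced e A] is the edge relation of   *)
(* the subgraph induced by [A], and has no edge at a vertex outside [A].       *)
Definition induced (T : finType) (e : rel T) (A : {set T}) : rel T :=
  [rel u v | [&& u \in A, v \in A & e u v]].

(* Vertices outside [A] are isolated in [induced e A], so each component is    *)
(* either inside [A] or disjoint from it; [n_comp _ A] counts the former.      *)
Definition ncomponents (T : finType) (e : rel T) (A : {set T}) : nat :=
  n_comp (induced e A) A.

Definition tough (R : numDomainType) (t : R) (T : finType) (e : rel T) : Prop :=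
  forall S : {set T}, 2 <= ncomponents e (~: S) ->
    (t * (ncomponents e (~: S))%:R <= #|S|%:R)%R.

(* [C] lists the vertices of a cycle in the order given by an orientation, so  *)
(* the successor of [u] on the oriented cycle is [next C u]; the opposite      *)
(* orientation is [rev C]. [ucycle] alone would also accept the empty list and *)
(* two adjacent vertices.                                                      *)
Definition hamilton_cycle (T : finType) (e : rel T) (A : {set T}) (C : seq T) :
    Prop :=
  [/\ ucycle (induced e A) C, 3 <= size C & C =i A].

Definition hamiltonian (T : finType) (e : rel T) : Prop :=
  exists C : seq T, hamilton_cycle e [set: T] C.

Definition neighbors (T : finType) (e : rel T) (u : T) : {set T} :=
  [set v | e u v].

Definition deg (T : finType) (e : rel T) (u : T) : nat := #|neighbors e u|.

(* Main.v *)
Require Import Defs.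
From mathcomp Require Import all_boot all_order all_algebra.
From mathcomp Require Import zify lra.

Import Order.TTheory GRing.Theory Num.Theory.

(** The cycle C, opened at x and y and rerouted through z, is a Hamilton path
    p_0 = x, ..., p_(n-1) = y of G.  Call j a bridge if x ~ p_(j+1) and
    y ~ p_(j-1), and i a gap if x is not adjacent to p_(i+1) and y is not
    adjacent to p_i.  As G is not Hamiltonian, x ~ p_(i+1) and y ~ p_i never hold
    together, so there are exactly n - 1 - deg x - deg y gaps, hence at most
    t - 1 if the theorem fails.  Every bridge plays the role of z with the same
    path: moving a neighbour of a bridge w one step towards w along the path
    gives again a bridge, unless a gap is near.  So, for b bridges and g gaps,
    deg z <= b + g + 1, and the independent set of bridges has at most
    2 b + 3 g neighbours.  Toughness at the neighbourhood of z gives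
    2 t <= deg z, so b >= t.  Deleting the neighbours of the bridges isolates
    the b bridges and leaves x, so t (b + 1) <= 2 b + 3 g <= 2 b + 3 (t - 1),
    which is impossible for t >= 4. *)

(** * Increasing and decreasing intervals of positions *)

Definition up (a b : nat) : seq nat := iota a (b.+1 - a).

Definition down (b a : nat) : seq nat := rev (up a b).

Lemma up1 a : up a a = [:: a].
Proof. by rewrite /up subSnn. Qed.

Lemma upS a b : a <= b -> up a b.+1 = rcons (up a b) b.+1.
Proof.
move=> le_ab; rewrite /up subSn; last by lia.
by rewrite -addn1 iotaD /= cats1 subnKC //; lia.
Qed.

Lemma down1 a : down a a = [:: a].
Proof. by rewrite /down up1. Qed.

Lemma downS a b : a <= b -> down b.+1 a = b.+1 :: down b a.
Proof. by move=> le_ab; rewrite /down upS // rev_rcons. Qed.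

Lemma mem_up a b i : (i \in up a b) = (a <= i <= b).
Proof. by rewrite mem_iota; lia. Qed.

Lemma mem_down a b i : (i \in down b a) = (a <= i <= b).
Proof. by rewrite mem_rev mem_up. Qed.

Lemma size_up a b : size (up a b) = b.+1 - a.
Proof. exact: size_iota. Qed.

Lemma size_down a b : size (down b a) = b.+1 - a.
Proof. by rewrite size_rev size_up. Qed.

Lemma leq_ind a (Q : nat -> Prop) :
  Q a -> (forall b, a <= b -> Q b -> Q b.+1) -> forall b, a <= b -> Q b.
Proof.
move=> Qa QS; elim=> [|b IH]; first by rewrite leqn0 => /eqP <-.
by rewrite leq_eqVlt => /predU1P[<- //|]; rewrite ltnS => le_ab; apply/QS/IH.
Qed.

Lemma last_up c a b : a <= b -> last c (up a b) = b.
Proof.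
by elim/leq_ind: b / => [|b le_ab _]; rewrite ?up1 // upS // last_rcons.
Qed.

Lemma last_down c a b : a <= b -> last c (down b a) = a.
Proof.
move=> le_ab; elim/leq_ind: b / le_ab c => [|b le_ab IH] c; first by rewrite down1.
by rewrite downS //= IH.
Qed.

(** * Chords that would turn a Hamilton path into a Hamilton cycle *)

Section HamiltonPath.

Variables (T : finType) (e : rel T) (p : nat -> T) (n : nat).
Hypotheses (esym : symmetric e) (cardT : #|T| = n) (n_ge3 : 3 <= n).
Hypotheses (p_surj : forall v, exists2 i, i < n & p i = v).
Hypothesis p_path : forall i, i.+1 < n -> e (p i) (p i.+1).
Hypothesis nonham : ~ hamiltonian e.

Let r : rel nat := fun i j => e (p i) (p j).

Let rC i j : r i j = r j i.
Proof. exact: esym. Qed.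

(** Successive positions are adjacent, so a block leaves only its entering edge to check. *)
Lemma path_up c a b : a <= b -> b < n -> path r c (up a b) = r c a.
Proof.
elim/leq_ind: b / => [|b le_ab IH] ltbn; first by rewrite up1 /= andbT.
by rewrite upS // rcons_path IH ?last_up // ?/(r b _) ?p_path ?andbT //; lia.
Qed.

Lemma path_down c a b : a <= b -> b < n -> path r c (down b a) = r c b.
Proof.
move=> le_ab; elim/leq_ind: b / le_ab c => [|b le_ab IH] c ltbn.
  by rewrite down1 /= andbT.
by rewrite downS //= IH ?(rC b.+1) ?/(r b _) ?p_path ?andbT //; lia.
Qed.

(** Starting the path at the last entry of [c] includes the closing edge. *)
Lemma hamiltonian_reorder (c : seq nat) :
  size c = n -> (forall i, i < n -> i \in c) -> path r (last 0 c) c -> False.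
Proof.
move=> size_c c_all path_c; apply: nonham.
have full (v : T) : v \in map p c.
  by have [i lt_in <-] := p_surj v; apply: map_f; apply: c_all.
exists (map p c); split; last by move=> v; rewrite full inE.
- apply/andP; split; last first.
    (* Pigeonhole: a list of [#|T|] entries that meets every vertex repeats none. *)
    apply: (@leq_size_uniq _ (enum T)) (enum_uniq _) _ _.
      by move=> v _; apply: full.
    by rewrite size_map size_c -cardE cardT.
  rewrite (@eq_cycle _ _ e); first by rewrite (cycle_path (p 0)) last_map path_map.
  by move=> u v; rewrite /induced /= !inE.
- by rewrite size_map size_c.
Qed.

Let m := n.-1.

(* A contradiction from a list [c] of positions along which the path closes up
   to a Hamilton cycle; what remains is the adjacency at the junctions. *)
Ltac reorder c :=
  apply: (@hamiltonian_reorder c);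
  [ by rewrite !size_cat ?size_up ?size_down /m; lia
  | by move=> ?; rewrite !mem_cat ?mem_up ?mem_down /m; lia
  | rewrite !cat_path !last_cat ?last_up ?last_down ?path_up ?path_down /m;
    try lia ].

Lemma crossing i : i.+1 < n -> r 0 i.+1 -> r m i -> False.
Proof.
move=> lt_in x_i y_i; reorder (up 0 i ++ down m i.+1).
by rewrite -/m !(rC i.+1, rC i) x_i y_i.
Qed.

(** The chords link the blocks i..0, i+1..j-1 and m..j cyclically, one chord per junction. *)
Lemma crossing2 i j : i.+1 < j -> j < n -> r 0 i.+1 -> r m j.-1 -> r i j -> False.
Proof.
move=> lt_ij lt_jn x_i y_j ij; reorder (down i 0 ++ up i.+1 j.-1 ++ down m j).
by rewrite -/m (rC j) ij x_i rC y_j.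
Qed.

Lemma left_y i j : i.+1 < j -> j.+1 < n -> r 0 j.+1 -> r i j -> r m i.+1 -> False.
Proof.
move=> lt_ij lt_jn x_j ij y_i; reorder (up 0 i ++ down j i.+1 ++ down m j.+1).
by rewrite -/m ij (rC i.+1) y_i rC x_j.
Qed.

Lemma right_x i j : 0 < j -> j.+1 < i -> i < n -> r m j.-1 -> r i j -> r 0 i.-1 -> False.
Proof.
move=> j0 lt_ij lt_jn y_j ij x_i; reorder (up 0 j.-1 ++ down m i ++ up j i.-1).
by rewrite -/m ij (rC j.-1) y_j rC x_i.
Qed.

(** Insert p_j between p_i and p_(i+1); the chords from p_(j-1) to y and from p_(j+1) to x close up
    the rest. *)
Lemma left_consecutive i j : i.+1 < j -> j.+1 < n ->
  r 0 j.+1 -> r m j.-1 -> r i j -> r i.+1 j -> False.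
Proof.
move=> lt_ij lt_jn x_j y_j ij ij'.
reorder (up 0 i ++ up j j ++ up i.+1 j.-1 ++ down m j.+1).
by rewrite -/m ij rC x_j rC ij' rC y_j.
Qed.

Lemma right_consecutive i j : 0 < j -> j.+1 < i -> i.+1 < n ->
  r 0 j.+1 -> r m j.-1 -> r i j -> r i.+1 j -> False.
Proof.
move=> j0 lt_ij lt_jn x_j y_j ij ij'.
reorder (up 0 j.-1 ++ down m i.+1 ++ up j j ++ down i j.+1).
by rewrite -/m ij' rC x_j rC y_j rC ij.
Qed.

(** Here j and h each supply only one end chord: j the one at x, h the one at y. *)
Lemma two_sided h i j : 0 < j -> j < i -> i.+1 < h -> h.+1 < n ->
  r 0 j.+1 -> r m h.-1 -> r i h -> r i.+1 j -> False.
Proof.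
move=> j0 lt_ji lt_ih lt_hn x_j y_h ih ij.
reorder (up 0 j ++ up i.+1 h.-1 ++ down m h ++ down i j.+1).
by rewrite -/m (rC j) ij rC x_j rC y_h rC ih.
Qed.

(** * Gaps and bridges, and their counts *)

Hypothesis eirr : irreflexive e.

Let gap i := [&& i.+1 < n, ~~ r m i & ~~ r 0 i.+1].

(** The two chords close up the path without p_j, in the order 0..j-1, m..j+1; hence p_j can replace
    z. *)
Let bridge j := [&& 0 < j, j.+1 < n, r 0 j.+1 & r m j.-1].

(** By [crossing2] and [left_y], p_(i+1) is adjacent to neither x nor y. So i is a gap unless y ~
    p_i, and i+1 is a gap unless x ~ p_(i+2); if both hold, i+1 is a bridge. *)
Let bridge_left {i j} : bridge j -> i < j -> r i j ->
  [|| gap i, gap i.+1 | bridge i.+1].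
Proof.
move=> brj lt_ij ij; have /and4P[j0 jn x_j y_j] := brj.
case: (eqVneq i.+1 j) => [-> | ne_ij]; first by rewrite brj !orbT.
have lt2 : i.+1 < j by lia.
have nx : ~~ r 0 i.+1 by apply/negP => /crossing2 H; apply: (H j); lia.
have ny : ~~ r m i.+1 by apply/negP; apply: (@left_y i j).
rewrite /gap /bridge nx ny /= !andbT.
by case: (r m i); case: (r 0 i.+2); rewrite /= ?andbT ?andbF ?orbF; lia.
Qed.

(** Mirror image: p_(i-1) is adjacent to neither x nor y, by [right_x] and [crossing2]. *)
Let bridge_right {i j} : bridge j -> j < i -> i < n -> r i j ->
  [|| gap i.-1, gap i.-2 | bridge i.-1].
Proof.
move=> brj lt_ji lt_in ij; have /and4P[j0 jn x_j y_j] := brj.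
case: i lt_ji lt_in ij => // i; rewrite ltnS leq_eqVlt => /predU1P[<- | lt_ji] lt_in ij.
  by rewrite brj !orbT.
have nx : ~~ r 0 i by apply/negP; apply: (@right_x i.+1 j).
have ny : ~~ r m i.
  by apply/negP => /(@crossing2 j i.+1) H; apply: H; rewrite // rC.
case: i nx ny lt_ji lt_in ij => // i nx ny lt_ji lt_in ij.
rewrite /gap /bridge /= nx ny lt_in /= !andbT.
by case: (r m i); case: (r 0 i.+2); rewrite /= ?andbT ?andbF ?orbF //; lia.
Qed.

Definition gaps : {set 'I_n} :=
  [set i : 'I_n | [&& i.+1 < n, ~~ e (p n.-1) (p i) & ~~ e (p 0) (p i.+1)]].

Definition bridges : {set 'I_n} :=
  [set j : 'I_n |
    [&& 0 < j, j.+1 < n, e (p 0) (p j.+1) & e (p n.-1) (p j.-1)]].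

Let gap_ord {k} : gap k -> exists2 o : 'I_n, o \in gaps & k = o.
Proof.
move=> gk; have /and3P[lt_k _ _] := gk.
by exists (Ordinal (ltnW lt_k)); rewrite ?inE.
Qed.

Let bridge_ord {k} : bridge k -> exists2 o : 'I_n, o \in bridges & k = o.
Proof.
move=> bk; have /and4P[_ lt_k _ _] := bk.
by exists (Ordinal (ltnW lt_k)); rewrite ?inE.
Qed.

(** Keeps x out of the neighbourhood of the bridges, so that x survives its deletion. *)
Lemma bridge_nonadj (j : 'I_n) : j \in bridges -> ~~ e (p 0) (p j).
Proof.
rewrite inE => /and4P[j0 jn _ y_j]; apply/negP => x_j.
by apply: (@crossing j.-1); rewrite ?prednK // ltnW.
Qed.

(** For i < j, the chord of i at x and that of j at y give [crossing2]; if j = i+1, the former would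
    join x to the bridge j. *)
Lemma bridges_indep (i j : 'I_n) :
  i \in bridges -> j \in bridges -> ~~ e (p i) (p j).
Proof.
wlog lt_ij: i j / i < j => [IH bi bj | bi bj].
  case: (ltngtP i j) => [| lt_ji | /val_inj ->]; [by move/IH; apply | | by rewrite eirr].
  by rewrite esym; apply: IH.
apply/negP => ij; have := bridge_nonadj j bj; move: bi bj; rewrite !inE.
case/and4P=> _ _ x_i _ /and4P[_ _ _ y_j].
case: (eqVneq i.+1 j) => [<- | ne_ij]; first by rewrite x_i.
by move=> _; apply: (@crossing2 i j) => //; lia.
Qed.

(** The neighbours of x, shifted back by one, the neighbours of y, and the gaps occupy pairwise
    disjoint sets of positions, by [crossing]; none contains the last position. *)
Lemma card_gaps : deg e (p 0) + deg e (p n.-1) + #|gaps| <= n.-1.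
Proof.
pose A := [set i : 'I_n | (i.+1 < n) && r 0 i.+1].
pose B := [set i : 'I_n | (i.+1 < n) && r m i].
have degx : deg e (p 0) <= #|A|.
  apply: leq_trans (leq_imset_card (fun i : 'I_n => p i.+1) A).
  apply/subset_leq_card/subsetP => v; rewrite inE.
  have [[|i] lt_in <-] := p_surj v; first by rewrite eirr.
  by move=> x_i; apply/imsetP; exists (Ordinal (ltnW lt_in)); rewrite ?inE ?lt_in.
have degy : deg e (p n.-1) <= #|B|.
  apply: leq_trans (leq_imset_card (fun i : 'I_n => p i) B).
  apply/subset_leq_card/subsetP => v; rewrite inE.
  have [i lt_in <-] := p_surj v => y_i.
  apply/imsetP; exists (Ordinal lt_in); rewrite ?inE //=.
  rewrite [r _ _]y_i andbT; case: (eqVneq i n.-1) => [Ei|]; last by lia.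
  by move: y_i; rewrite Ei eirr.
have dAB : [disjoint A & B].
  rewrite -setI_eq0; apply/eqP/setP => i; rewrite !inE.
  by apply/negbTE/negP => /andP[/andP[lt_in xi] /andP[_ yi]]; apply: (@crossing i).
have dM : [disjoint A :|: B & gaps].
  rewrite -setI_eq0; apply/eqP/setP => i; rewrite !inE -/(r _ _) -/(r _ _).
  by case: (_ < n); case: (r _ _); case: (r _ _).
have /eqP EAB : #|A :|: B| == #|A| + #|B| by rewrite (leq_card_setU A B).2.
have /eqP EM : #|A :|: B :|: gaps| == #|A :|: B| + #|gaps|.
  by rewrite (leq_card_setU _ _).2.
apply: leq_trans (_ : #|A| + #|B| + #|gaps| <= _); first by rewrite leq_add2r leq_add.
rewrite -EAB -EM.
have lt_mn : n.-1 < n by lia.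
rewrite -[X in _ <= X.-1]card_ord -(cardsC1 (Ordinal lt_mn)).
apply/subset_leq_card/subsetP => i; rewrite !inE -(inj_eq val_inj) /=.
by case: eqP => // ->; rewrite (_ : n.-1.+1 < n = false) //; lia.
Qed.

(* In [g]: p_k and p_(k-1) are not both adjacent to a bridge further right, so
   each gap accounts for at most one neighbour. *)
Lemma deg_bridge (j : 'I_n) :
  j \in bridges -> deg e (p j) <= (#|bridges| + #|gaps|).+1.
Proof.
rewrite inE => brj; have /and4P[j0 jn x_j y_j] := brj.
(* Both p_(j-1) and p_(j+1) lead to the bridge j itself. As [f] sends j to p_(j-1), the vertex
   p_(j+1) is listed apart in [sub]; this is the extra 1 in the bound. *)
pose f (k : 'I_n) := if k <= j then p k.-1 else p k.+1.
pose g (k : 'I_n) := if k < j then if r k j then p k else p k.-1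
                     else if r k.+1 j then p k.+1 else p k.+2.
have sub : neighbors e (p j) \subset p j.+1 |: (f @: bridges :|: g @: gaps).
  apply/subsetP => v; rewrite inE esym.
  have [i lt_in <-] := p_surj v => ij.
  rewrite !inE; case: (ltngtP i j) => [lt_ij | lt_ji | Eij]; last first.
  - by move: ij; rewrite Eij eirr.
  - case: (eqVneq i j.+1) => [-> | ne_ij]; first by rewrite eqxx.
    have lt2 : j.+1 < i by lia.
    apply/orP; right; case/or3P: (bridge_right brj lt_ji lt_in ij).
    + case/gap_ord => k gk Ek; apply/orP; right; apply/imsetP; exists k => //.
      rewrite /g -Ek prednK ?(leq_ltn_trans _ lt_ji) // [r i j]ij.
      by rewrite ifN //; lia.
    + move=> gi; case/gap_ord: (gi) => k gk Ek; apply/orP; right.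
      apply/imsetP; exists k => //.
      have ne : k.+1 <> j.
        move=> E; case/and3P: gi => _ /negP[].
        by rewrite Ek; move: y_j; rewrite -E.
      have ne' : k <> j :> nat.
        by move=> E; case/and3P: gi; rewrite Ek E [r 0 _]x_j.
      rewrite /g ifN ?ifN; first by congr p; lia.
        have Ei : i = k.+2 by move: Ek lt2; clear; lia.
        (* On the right of j, p_(k+1) and p_(k+2) are not both adjacent to p_j, so [g] picks p_(k+2)
           here. *)
        apply/negP => ik; apply: (@right_consecutive k.+1 j); rewrite -?Ei //.
        by move: lt2 ne'; rewrite Ei; clear; lia.
      by move: ne ne' lt2 Ek; clear; lia.
    + case/bridge_ord => k bk Ek; apply/orP; left; apply/imsetP; exists k => //.
      by rewrite /f ifN -?Ek; first (congr p; lia); lia.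
  - apply/orP; right; case/or3P: (bridge_left brj lt_ij ij).
    + case/gap_ord => k gk Ek; apply/orP; right; apply/imsetP; exists k => //.
      by rewrite /g -Ek lt_ij [r i j]ij.
    + move=> gi; case/gap_ord: (gi) => k gk Ek; apply/orP; right.
      apply/imsetP; exists k => //.
      have ne : i.+1 <> j by move=> E; case/and3P: gi; rewrite E [r 0 _]x_j.
      have lt2 : i.+1 < j by lia.
      rewrite /g -Ek lt2 ifN //; apply/negP => ik.
      exact: (@left_consecutive i j).
    + case/bridge_ord => k bk Ek; apply/orP; left; apply/imsetP; exists k => //.
      by rewrite /f -Ek lt_ij.
apply: leq_trans (subset_leq_card sub) _.
rewrite cardsU1 -[_.+1]add1n; apply: leq_add (leq_b1 _) _.
by apply: leq_trans (leq_card_setU _ _) _; rewrite leq_add ?leq_imset_card.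
Qed.

Definition bridge_nbrs : {set T} := [set v | [exists j in bridges, e v (p j)]].

(* The factor 3, and not 4, of the gaps comes from [two_sided]: a gap k cannot
   account both for p_k adjacent to a bridge on its right and for p_(k+1)
   adjacent to a bridge on its left. *)
Lemma card_bridge_nbrs : #|bridge_nbrs| <= 2 * #|bridges| + 3 * #|gaps|.
Proof.
pose f (k : 'I_n) :=
  if [exists j in bridges, (k < j) && r k j] then p k else p k.+1.
(* A bridge k accounts for p_(k-1) and p_(k+1). A gap k accounts for p_k or p_(k-1) on the left of a
   bridge, and for p_(k+1) or p_(k+2) on the right; [f] merges p_k and p_(k+1). *)
have sub : bridge_nbrs \subset
    [set p k.-1 | k : 'I_n in bridges] :|: [set p k.+1 | k : 'I_n in bridges]
    :|: [set f k | k in gaps] :|: [set p k.-1 | k : 'I_n in gaps]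
    :|: [set p k.+2 | k : 'I_n in gaps].
  apply/subsetP => v; rewrite inE; have [i lt_in <-] := p_surj v.
  case/exists_inP => j bj ij; have brj : bridge j by rewrite inE in bj.
  have /and4P[j0 jn x_j y_j] := brj.
  case: (ltngtP i j) => [lt_ij | lt_ji | Eij]; last first.
  - by move: ij; rewrite Eij eirr.
  - case/or3P: (bridge_right brj lt_ji lt_in ij).
    + move=> gi; case/gap_ord: (gi) => k gk Ek.
      suff ->: p i = f k by rewrite !inE imset_f ?orbT.
      have Ei : i = k.+1 by lia.
      have ne : k <> j :> nat.
        by move=> E; case/and3P: gi; rewrite Ek E [r 0 _]x_j.
      rewrite /f ifN; first by rewrite Ei.
      (* A bridge h that made [f] choose p_k would give [two_sided] with j. Its strict inequalities
         hold: k = j contradicts x ~ p_(j+1), and h = k+1 contradicts y ~ p_(h-1). *)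
      apply/negP => /exists_inP[h bh /andP[lt_kh kh]].
      have /and4P[h0 hn x_h y_h] : bridge h by rewrite inE in bh.
      have ne2 : k.+1 <> h :> nat.
        by move=> E; case/and3P: gi => _ /negP[]; rewrite Ek; move: y_h; rewrite -E.
      have lt_jk : j < k by move: lt_ji ne; rewrite Ei; clear; lia.
      have lt_kh2 : k.+1 < h by rewrite ltn_neqAle lt_kh andbT; apply/eqP.
      by apply: (@two_sided h k j) => //; rewrite -Ei.
    + move=> gi; case/gap_ord: (gi) => k gk Ek.
      have -> : p i = p k.+2 by congr p; lia.
      by rewrite !inE (imset_f (fun k : 'I_n => p k.+2)) ?orbT.
    + case/bridge_ord => k bk Ek; have -> : p i = p k.+1 by congr p; lia.
      by rewrite !inE (imset_f (fun k : 'I_n => p k.+1)) ?orbT.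
  - case/or3P: (bridge_left brj lt_ij ij).
    + case/gap_ord => k gk Ek.
      suff ->: p i = f k by rewrite !inE imset_f ?orbT.
      rewrite /f ifT ?Ek //; apply/exists_inP; exists j => //.
      by rewrite -Ek lt_ij.
    + case/gap_ord => k gk Ek; have -> : p i = p k.-1 by congr p; lia.
      by rewrite !inE (imset_f (fun k : 'I_n => p k.-1) gk) ?orbT.
    + case/bridge_ord => k bk Ek; have -> : p i = p k.-1 by congr p; lia.
      by rewrite !inE (imset_f (fun k : 'I_n => p k.-1) bk) ?orbT.
apply: leq_trans (subset_leq_card sub) _.
have -> : 2 * #|bridges| + 3 * #|gaps| =
  #|bridges| + #|bridges| + #|gaps| + #|gaps| + #|gaps| by lia.
do 4!(apply: leq_trans (leq_card_setU _ _) _;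
      apply: leq_add; last exact: leq_imset_card).
exact: leq_imset_card.
Qed.

End HamiltonPath.

(** * Final arithmetic and toughness *)

Lemma tough_counting (t : rat) (n dx dy dz g b s : nat) :
    (4 <= t)%R -> 0 < n -> dx + dy + g <= n.-1 -> dz <= (b + g).+1 ->
    s <= 2 * b + 3 * g -> (t * 2%:R <= dz%:R)%R -> (t * b.+1%:R <= s%:R)%R ->
  (dx%:R + dy%:R < n%:R - t)%R.
Proof.
move=> t_ge4 n_gt0 gapsP degP nbrsP tdeg tbridges.
have {}gapsP : (dx%:R + dy%:R + g%:R + 1 <= n%:R :> rat)%R.
  by rewrite -!natrD natr1 ler_nat; lia.
have {}degP : (dz%:R <= b%:R + g%:R + 1 :> rat)%R.
  by rewrite -natrD natr1 ler_nat.
have {}nbrsP : (s%:R <= 2 * b%:R + 3 * g%:R :> rat)%R.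
  by rewrite -!natrM -natrD ler_nat.
rewrite -natr1 in tbridges; rewrite ltNge; apply/negP => le_n.
(* Negating the goal gives g <= t - 1, hence b >= t. The two products supply the nonlinear part:
   with [tbridges] they give 4t <= t^2 <= 4t - 3. *)
have tb : (0 <= (t - 2) * (b%:R - t))%R by rewrite mulr_ge0; lra.
have tt : (0 <= t * (t - 4))%R by rewrite mulr_ge0; lra.
lra.
Qed.

(** Each vertex of [K] is a component by itself, and the component of [x] is one more. Components
    are counted by their roots. *)
Lemma ncomponents_isolated (T : finType) (e : rel T) (A K : {set T}) (x : T) :
    symmetric e -> K \subset A -> x \in A -> x \notin K ->
    {in K & A, forall u v, ~~ e u v} ->
  #|K| < ncomponents e A.
Proof.
move=> esym /subsetP subKA xA xK iso.
have csym : connect_sym (induced e A).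
  by apply: sym_connect_sym => u v; rewrite /induced /= esym andbCA.
have isoK u v : u \in K -> connect (induced e A) u v -> v = u.
  move=> uK /connectP[[|w s] //= /andP[/and3P[_ wA uw] _] _].
  by have := iso u w uK wA; rewrite uw.
have rootA v : v \in A -> fingraph.root (induced e A) v \in A.
  move=> vA; have := connect_root (induced e A) v.
  rewrite csym => /connectP[[|w s] /=]; first by move=> _ <-.
  by case/andP=> /and3P[].
have rK : fingraph.root (induced e A) x \notin K.
  apply: contra xK => rK.
  have -> : x = fingraph.root (induced e A) x.
    by apply: (isoK _ x rK); rewrite csym connect_root.
  exact: rK.
have <- : #|fingraph.root (induced e A) x |: K| = #|K|.+1 by rewrite cardsU1 rK.
apply/subset_leq_card/subsetP => v; rewrite !inE => /predU1P[-> | vK].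
  by rewrite roots_root // rootA.
by rewrite subKA // andbT; apply/eqP/(isoK v); rewrite ?connect_root.
Qed.

(** * From the cycle avoiding z to the path from x to y *)

Theorem theorem6 (t : rat) (T : finType) (e : rel T) (n : nat)
    (esym : symmetric e) (eirr : irreflexive e)
    (cardT : #|T| = n) (n_ge3 : 3 <= n)
    (t_ge4 : (4 <= t)%R) (etough : tough t e)
    (nonham : ~ hamiltonian e)
    (z : T) (C : seq T) (Cham : hamilton_cycle e [set~ z] C)
    (x y : T) (x_in : x \in next C @: neighbors e z)
    (y_in : y \in next C @: neighbors e z) (xy : x != y) :
  ((deg e x)%:R + (deg e y)%:R < n%:R - t)%R.
Proof.
case: Cham => /andP[cycC uniqC] size_C memC.
case/imsetP: x_in => u; rewrite inE => zu xE.
case/imsetP: y_in => v; rewrite inE => zv yE.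
have inC w : e z w -> w \in C.
  by move=> zw; rewrite memC !inE; apply: contraTneq zw => ->; rewrite eirr.
have xC : x \in C by rewrite xE mem_next inC.
have yC : y \in C by rewrite yE mem_next inC.
have [i s1 s2 _ _ Crot] := rot_to_arc uniqC xC yC xy.
have nextC : fcycle (next C) (x :: s1 ++ y :: s2).
  by rewrite -Crot rot_cycle cycle_next.
have {cycC} : cycle (induced e [set~ z]) (x :: s1 ++ y :: s2).
  by rewrite -Crot rot_cycle.
(* Injectivity of [next] identifies v and u as the last vertices of the arcs starting at x and y. *)
have nextI := can_inj (prev_next uniqC).
move: nextC; rewrite /= rcons_path cat_path last_cat /=.
case/andP=> /and3P[_ /eqP vE _] /eqP uE.
have {vE} vE : v = last x s1 by apply: nextI; rewrite vE yE.
have {uE} uE : u = last y s2 by apply: nextI; rewrite uE xE.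
rewrite rcons_path cat_path last_cat /= => /andP[/and3P[path1 vy path2] ux].
have ind_e : subrel (induced e [set~ z]) e by move=> a b /and3P[].
have {}vy : e y v by rewrite vE esym ind_e.
have {}ux : e x u by rewrite uE esym ind_e.
have {}path1 := sub_path ind_e path1.
have {}path2 := sub_path ind_e path2.
(* Follow C from x to v, step to z and then to u, and follow C backwards to y. *)
pose P := (x :: s1) ++ z :: rev (y :: s2).
have memP w : w \in P.
  rewrite mem_cat !in_cons mem_rev in_cons; have := memC w.
  rewrite -(mem_rot i) Crot -cat_cons mem_cat !inE.
  by case: (w == z); case: (w == x); case: (w == y); case: (w \in s1);
     case: (w \in s2).
have sizeP : size P = n.
  have := card_uniqP uniqC; rewrite (eq_card memC) cardsC1 cardT.
  rewrite -(size_rot i) Crot /= !size_cat /= size_rev /=; move: n_ge3; clear; lia.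
pose p k := nth z P k.
have n_gt0 : 0 < n by apply: leq_trans n_ge3.
have p_surj w : exists2 k, k < n & p k = w.
  by exists (index w P); rewrite /p ?nth_index // -sizeP index_mem.
have pathxy : path e x (s1 ++ z :: rev (y :: s2)).
  rewrite cat_path path1 /= -vE esym zv /=.
  have := rev_path e y s2; rewrite -uE (eq_path (e' := e)) ?path2 => [|a b]; last exact: esym.
  by rewrite lastI rev_rcons -uE /= zu.
have p_path k : k.+1 < n -> e (p k) (p k.+1).
  move=> lt_kn; have /(pathP z)/(_ k) := pathxy; apply.
  by move: lt_kn; rewrite -sizeP /P /= ltnS.
have p0 : p 0 = x by [].
have pl : p n.-1 = y.
  by rewrite -sizeP /p nth_last last_cat /= rev_cons last_rcons.
have p_inj k1 k2 : k1 < n -> k2 < n -> p k1 = p k2 -> k1 = k2.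
  move=> lt1 lt2 /eqP; rewrite nth_uniq ?sizeP //; first by move/eqP.
  apply: (leq_size_uniq (enum_uniq T)) => [w _ | ]; first exact: memP.
  by rewrite sizeP -cardT cardE.
have zj : p (size s1).+1 = z by rewrite /p nth_cat /= ltnn subnn.
have lt_j : (size s1).+2 < n by rewrite -sizeP size_cat /= size_rev /= !addnS !ltnS leq_addr.
pose j := Ordinal (ltnW lt_j).
(* The path neighbours of z are v and u, and the required chords y v and x u are the edges of C that
   the path leaves out. *)
have j_bridge : j \in bridges T e p n.
  have pv : p (size s1) = v.
    by rewrite /p nth_cat ltnSn -[size s1]/((size (x :: s1)).-1) nth_last.
  have pu : p (size s1).+2 = u.
    rewrite /p nth_cat /= ltnNge ltnW //= subSn // subnn /= nth_rev //= subn1.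
    by rewrite -[size s2]/((size (y :: s2)).-1) nth_last.
  by rewrite inE /= lt_j p0 pl pv pu ux vy.
have gapsP := card_gaps T e p n esym cardT n_ge3 p_surj p_path nonham eirr.
have degP := deg_bridge T e p n esym cardT n_ge3 p_surj p_path nonham eirr j j_bridge.
have nbrsP := card_bridge_nbrs T e p n esym cardT n_ge3 p_surj p_path nonham eirr.
rewrite p0 pl in gapsP; rewrite zj in degP.
have nonadj := bridge_nonadj T e p n esym cardT n_ge3 p_surj p_path nonham.
have indep := bridges_indep T e p n esym cardT n_ge3 p_surj p_path nonham eirr.
have t_gt0 : (0 < t)%R by apply: lt_le_trans t_ge4.
(* A nonempty [K] together with [x] yields the two components that toughness requires. *)
have toughK (S K : {set T}) : 0 < #|K| -> K \subset ~: S -> x \notin S ->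
    x \notin K -> {in K & ~: S, forall a b, ~~ e a b} ->
    (t * (#|K|.+1)%:R <= #|S|%:R)%R.
  move=> K0 KS xS xK iso.
  have lt_K : #|K| < ncomponents e (~: S).
    by apply: (@ncomponents_isolated T e _ K x) => //; rewrite inE.
  apply: le_trans (etough S (leq_trans _ lt_K)); last by rewrite ltnS.
  by rewrite ler_pM2l // ler_nat.
have xz : ~~ e x z by rewrite -p0 -zj; apply: (nonadj j).
have tdeg : (t * 2%:R <= (deg e z)%:R)%R.
  (* Deleting N(z) isolates z and leaves x; the 2 is rewritten as [#|[set z]|.+1] to fit
     [toughK]. *)
  rewrite -[2](congr1 S (cards1 z)); apply: toughK; rewrite ?cards1 //.
  - by rewrite sub1set !inE eirr.
  - by rewrite inE esym.
  - by rewrite inE; have := xC; rewrite memC !inE.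
  - by move=> a b; rewrite !inE => /eqP ->.
have tbridges : (t * (#|bridges T e p n|.+1)%:R <= #|bridge_nbrs T e p n|%:R)%R.
  have p_injb : {in bridges T e p n &, injective (fun k : 'I_n => p k)}.
    by move=> k1 k2 _ _ /p_inj Ek; apply/val_inj/Ek.
  rewrite -(card_in_imset p_injb); apply: toughK.
  - by rewrite (card_in_imset p_injb); apply/card_gt0P; exists j.
  - apply/subsetP => _ /imsetP[k bk ->]; rewrite !inE.
    by apply/exists_inP => -[l bl]; apply/negP/indep.
  - rewrite inE; apply/exists_inP => -[l bl]; apply/negP; rewrite -p0.
    exact: nonadj.
  - apply/imsetP => -[k bk]; rewrite -p0 => /p_inj k0.
    by move: bk; rewrite inE -k0.
  - move=> _ b /imsetP[k bk ->]; rewrite !inE; apply: contra => kb.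
    by apply/exists_inP; exists k; rewrite // esym.
move: gapsP degP nbrsP tdeg tbridges.
exact: tough_counting.
Qed.
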